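(* Let $(k,f)$ and $(K,F)$ be compatible pairs of a Lie-Poisson structure and of a quadratic Poisson structure on $\mathbb{R}^3$, respectively, and write $f=(AX,X)$ with $A$ a symmetric $3\times3$ matrix. Then $$(K,F)\in\mathcal{C}_{k,f}\iff \hat{k}F=-\frac16\,X(12A+\widetilde{k})KX^T.$$ In particular, in the unimodular case $k=0$, $$\mathcal{C}_{0,f}=\{(K,F)\in\mathcal{C}\mid\hat{K}f=0\},$$ i.e. (for $(K,F)\in\mathcal C$) the condition is $K\in Der_0(\mathfrak{g})$.
   Context: All objects are real; $X=(x,y,z)=(x_1,x_2,x_3)$ is the row vector of coordinates on $\mathbb{R}^3$. For a matrix $A=(a_{ij})$, $\hat{A}=\sum_{i,j}a_{ij}x_j\frac{\partial}{\partial x_i}$ ($I$ is the identity matrix); for $k\in\mathbb{R}^3$, $\hat{k}=\sum_ik_i\frac{\partial}{\partial x_i}$. For a function $g$, $$\pi_g=\frac{\partial g}{\partial x}\frac{\partial}{\partial y}\wedge\frac{\partial}{\partial z}+\frac{\partial g}{\partial y}\frac{\partial}{\partial z}\wedge\frac{\partial}{\partial x}+\frac{\partial g}{\partial z}\frac{\partial}{\partial x}\wedge\frac{\partial}{\partial y}.$$ Linear case: a compatible pair $(k,f)$ consists of $k\in\mathbb{R}^3$ and a homogeneous quadratic polynomial $f$ with $\hat{k}f=0$; it gives the linear (Lie-)Poisson structure $\pi_{k,f}=\frac12\hat{I}\wedge\hat{k}+\pi_f$, with corresponding Lie algebra $\mathfrak{g}$ (so $\mathfrak{g}^*=\mathbb{R}^3$).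 $Der_0(\mathfrak{g})$ is the algebra of traceless derivations of $\mathfrak{g}$, identified with $\{D\in\mathfrak{sl}(3)\mid Dk=0,\ \hat{D}f=0\}$. Quadratic case: a compatible pair $(K,F)$ consists of $K\in\mathfrak{sl}(3)$ and a homogeneous cubic polynomial $F$ with $\hat{K}F=0$; it gives the quadratic Poisson structure $\pi_{K,F}=\frac13\hat{I}\wedge\hat{K}+\pi_F$. The set of all these pairs is $\mathcal{C}$. Put $$\mathcal{C}_{k,f}=\{(K,F)\in\mathcal{C}\mid[\pi_{k,f},\pi_{K,F}]=0\},$$ where $[\cdot,\cdot]$ is the Schouten bracket; equivalently, those $(K,F)$ for which $\pi_{k,f}+\pi_{K,F}$ is a Poisson structure. $\widetilde{k}:\mathfrak{g}^*\to\mathfrak{g}$ is the skew-symmetric $3\times3$ matrix corresponding to the bivector $k_1\frac{\partial}{\partial y}\wedge\frac{\partial}{\partial z}+k_2\frac{\partial}{\partial z}\wedge\frac{\partial}{\partial x}+k_3\frac{\partial}{\partial x}\wedge\frac{\partial}{\partial y}$, with the sign convention $\widetilde{k}v=k\times v$ (cross product); e.g. for $k=(0,0,1)^T$, $\widetilde{k}=\begin{pmatrix}0&-1&0\\1&0&0\\0&0&0\end{pmatrix}$. *)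

(* Defs.v *)
From HB Require Import structures.
From mathcomp Require Import all_boot all_order all_algebra.
From mathcomp Require Import ring mpoly.
From mathcomp Require Import classical_sets reals.

Set Implicit Arguments.
Unset Strict Implicit.
Unset Printing Implicit Defensive.

Import GRing.Theory Num.Theory.
Local Open Scope classical_set_scope.
Local Open Scope ring_scope.

(* Coordinates are indexed by 'I_3, so (x, y, z) = ('X_0, 'X_1, 'X_2).  A
   polynomial vector field is the column of its components; a bivector field is
   the skew-symmetric matrix P with P i j = {x_i, x_j}.                        *)
Notation vfield R := 'cV[{mpoly R[3]}]_3.
Notation bivector R := 'M[{mpoly R[3]}]_3.

Definition coords (R : realType) : 'rV[{mpoly R[3]}]_3 := \row_i 'X_i.

Definition hat_mx (R : realType) (A : 'M[R]_3) : vfield R :=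
  map_mx (@mpolyC 3 R) A *m (coords R)^T.

Definition hat_vec (R : realType) (k : 'cV[R]_3) : vfield R :=
  map_mx (@mpolyC 3 R) k.

Definition lie_der (R : realType) (u : vfield R) (g : {mpoly R[3]}) :
  {mpoly R[3]} := \sum_i u i 0 * mderiv i g.

Definition wedge (S : pzRingType) (u v : 'cV[S]_3) : 'M[S]_3 :=
  u *m v^T - v *m u^T.

Definition basis_vec (S : pzRingType) (i : 'I_3) : 'cV[S]_3 := delta_mx i 0.

(* w_1 d/dy ^ d/dz + w_2 d/dz ^ d/dx + w_3 d/dx ^ d/dy *)
Definition bivec_of (S : pzRingType) (w : 'cV[S]_3) : 'M[S]_3 :=
  w 0 0 *: wedge (basis_vec S 1) (basis_vec S 2)
  + w 1 0 *: wedge (basis_vec S 2) (basis_vec S 0)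
  + w 2 0 *: wedge (basis_vec S 0) (basis_vec S 1).

Definition pi_fun (R : realType) (g : {mpoly R[3]}) : bivector R :=
  bivec_of (\col_i mderiv i g).

(* Components of the Schouten bracket of two bivector fields; schouten_wedge
   checks them against the usual rule for decomposable bivectors.              *)
Definition schouten (R : realType) (P Q : bivector R) (i j k : 'I_3) :
    {mpoly R[3]} :=
  \sum_l (P i l * mderiv l (Q j k) + Q i l * mderiv l (P j k)
        + P j l * mderiv l (Q k i) + Q j l * mderiv l (P k i)
        + P k l * mderiv l (Q i j) + Q k l * mderiv l (P i j)).

Definition schouten_commute (R : realType) (P Q : bivector R) : Prop :=
  forall i j k, schouten P Q i j k = 0.

Definition lin_compatible (R : realType) (k : 'cV[R]_3) (f : {mpoly R[3]}) :
  Prop := f \is 2.-homog /\ lie_der (hat_vec k) f = 0.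

Definition pi_lin (R : realType) (k : 'cV[R]_3) (f : {mpoly R[3]}) :
  bivector R :=
  (2^-1)%:MP *: wedge (hat_mx 1%:M) (hat_vec k) + pi_fun f.

Definition quad_compatible (R : realType) :
    set ('M[R]_3 * {mpoly R[3]}) :=
  [set p | \tr p.1 = 0 /\ p.2 \is 3.-homog /\ lie_der (hat_mx p.1) p.2 = 0].

Definition pi_quad (R : realType) (K : 'M[R]_3) (F : {mpoly R[3]}) :
  bivector R :=
  (3^-1)%:MP *: wedge (hat_mx 1%:M) (hat_mx K) + pi_fun F.

Definition Cset (R : realType) (k : 'cV[R]_3) (f : {mpoly R[3]}) :
    set ('M[R]_3 * {mpoly R[3]}) :=
  [set p | quad_compatible p /\
           schouten_commute (pi_lin k f) (pi_quad p.1 p.2)].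

(* The form X M X^T *)
Definition qform (R : realType) (M : 'M[R]_3) : {mpoly R[3]} :=
  (coords R *m map_mx (@mpolyC 3 R) M *m (coords R)^T) 0 0.

(* The opposite sign comes from the convention tilde_mx k *m v = k x v; see
   tilde_mxE.                                                                  *)
Definition tilde_mx (R : realType) (k : 'cV[R]_3) : 'M[R]_3 := - bivec_of k.

Definition pbracket (R : realType) (P : bivector R) (g h : {mpoly R[3]}) :
  {mpoly R[3]} := \sum_i \sum_j P i j * mderiv i g * mderiv j h.

(* The Lie algebra of (k, f) is the space of linear forms on R^3 under the
   Poisson bracket.  A matrix D acts on it by the vector field hat_mx D, that is
   by the transpose of its action X |-> D X on the dual R^3; der0P gives the
   description through k and f.                                                *)
Definition Der0 (R : realType) (k : 'cV[R]_3) (f : {mpoly R[3]}) :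
    set 'M[R]_3 :=
  [set D | \tr D = 0 /\
     forall u v : {mpoly R[3]}, u \is 1.-homog -> v \is 1.-homog ->
       let P := pi_lin k f in
       lie_der (hat_mx D) (pbracket P u v) =
       pbracket P (lie_der (hat_mx D) u) v
       + pbracket P u (lie_der (hat_mx D) v)].

Section Sanity.
Variable R : realType.

Let sum3 (S : nmodType) (F : 'I_3 -> S) : \sum_i F i = F 0 + F 1 + F 2.
Proof.
rewrite !big_ord_recr big_ord0 /= add0r.
by congr (F _ + F _ + F _); apply: val_inj.
Qed.

Let ord3P (i : 'I_3) : [\/ i = 0, i = 1 | i = 2].
Proof.
by case: i => [[|[|[|//]]]] h;
  [apply: Or31|apply: Or32|apply: Or33]; apply: val_inj.
Qed.

Lemma tilde_mxE (k v : 'cV[R]_3) :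
  tilde_mx k *m v = \col_i (k (i + 1) 0 * v (i + 2) 0 - k (i + 2) 0 * v (i + 1) 0).
Proof.
apply/matrixP => i j; rewrite !ord1 !mxE sum3 /bivec_of /wedge.
do ?rewrite !mxE ?big_ord1.
case: (ord3P i) => ->; rewrite /=.
- rewrite !add0r; ring.
- have [-> ->] : (1 : 'I_3) + 1 = 2 /\ (1 : 'I_3) + 2 = 0 by split; apply: val_inj.
  ring.
- have [-> ->] : (2 : 'I_3) + 1 = 0 /\ (2 : 'I_3) + 2 = 1 by split; apply: val_inj.
  ring.
Qed.

Definition vbracket (u v : vfield R) : vfield R :=
  \col_i (lie_der u (v i 0) - lie_der v (u i 0)).

Definition wedge3 (u v w : vfield R) (i j k : 'I_3) : {mpoly R[3]} :=
  u i 0 * wedge v w j k + u j 0 * wedge v w k i + u k 0 * wedge v w i j.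

Let schouten_wedge_l (S : comPzRingType) (a b c d a' b' c' d' : 'I_3 -> S)
    (al bl cl dl : S) (i j k : 'I_3) :
  let P i j := a i * b j - b i * a j in
  let Q i j := c i * d j - d i * c j in
  let P' i j := a' i * b j + a i * b' j - (b' i * a j + b i * a' j) in
  let Q' i j := c' i * d j + c i * d' j - (d' i * c j + d i * c' j) in
  let pl i := a i * bl - b i * al in
  let ql i := c i * dl - d i * cl in
  let w3 (u v w : 'I_3 -> S) := u i * (v j * w k - w j * v k)
     + u j * (v k * w i - w k * v i) + u k * (v i * w j - w i * v j) in
  pl i * Q' j k + ql i * P' j k + pl j * Q' k i + ql j * P' k i
  + pl k * Q' i j + ql k * P' i j =
  w3 (fun i => al * c' i - cl * a' i) b d
  - w3 (fun i => al * d' i - dl * a' i) b c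
  - w3 (fun i => bl * c' i - cl * b' i) a d
  + w3 (fun i => bl * d' i - dl * b' i) a c.
Proof.
move=> /=.
move: (a i) (a j) (a k) (b i) (b j) (b k) (c i) (c j) (c k) (d i) (d j) (d k).
move: (a' i) (a' j) (a' k) (b' i) (b' j) (b' k).
move: (c' i) (c' j) (c' k) (d' i) (d' j) (d' k).
move=> *.
ring.
Qed.

Lemma schouten_wedge (u1 u2 v1 v2 : vfield R) i j k :
  schouten (wedge u1 u2) (wedge v1 v2) i j k =
    wedge3 (vbracket u1 v1) u2 v2 i j k - wedge3 (vbracket u1 v2) u2 v1 i j k
  - wedge3 (vbracket u2 v1) u1 v2 i j k + wedge3 (vbracket u2 v2) u1 v1 i j k.
Proof.
have wE (u v : vfield R) i' j' : wedge u v i' j' = u i' 0 * v j' 0 - v i' 0 * u j' 0.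
  by rewrite !mxE !big_ord1 !mxE.
have dE l (u v : vfield R) i' j' : mderiv l (wedge u v i' j') =
    mderiv l (u i' 0) * v j' 0 + u i' 0 * mderiv l (v j' 0)
    - (mderiv l (v i' 0) * u j' 0 + v i' 0 * mderiv l (u j' 0)).
  by rewrite wE linearB /= !mderivM.
have bE (u v : vfield R) i' : vbracket u v i' 0 =
    \sum_l (u l 0 * mderiv l (v i' 0) - v l 0 * mderiv l (u i' 0)).
  by rewrite mxE /lie_der sumrB.
pose w3 (u v w : 'I_3 -> {mpoly R[3]}) := u i * (v j * w k - w j * v k)
     + u j * (v k * w i - w k * v i) + u k * (v i * w j - w i * v j).
pose br (u v : vfield R) l i' :=
  u l 0 * mderiv l (v i' 0) - v l 0 * mderiv l (u i' 0).
have w3E u v w : wedge3 (vbracket u v) w.1 w.2 i j k =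
    \sum_l w3 (br u v l) (w.1^~ 0) (w.2^~ 0).
  rewrite /wedge3 /w3 !bE !wE [RHS]big_split /= [X in _ = X + _]big_split /= !mulr_suml.
  by [].
rewrite (w3E _ _ (u2, v2)) (w3E _ _ (u2, v1)) (w3E _ _ (u1, v2)).
rewrite (w3E _ _ (u1, v1)) /= -!sumrB -big_split /=.
move: (wedge u1 u2) (wedge v1 v2) (wE u1 u2) (wE v1 v2)
  (fun l => dE l u1 u2) (fun l => dE l v1 v2).
move=> P Q PE QE dP dQ.
apply/eq_bigr=> l _.
rewrite !dP !dQ !PE !QE.
exact: (schouten_wedge_l (u1^~ 0) (u2^~ 0) (v1^~ 0) (v2^~ 0)
  (fun i => mderiv l (u1 i 0)) (fun i => mderiv l (u2 i 0))
  (fun i => mderiv l (v1 i 0)) (fun i => mderiv l (v2 i 0))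
  (u1 l 0) (u2 l 0) (v1 l 0) (v2 l 0) i j k).
Qed.

Let xderE i j : mderiv i 'X_j = (i == j)%:R :> {mpoly R[3]}.
Proof.
rewrite mderivX mnm1E eq_sym; case: eqP => [->|_]; last by rewrite scale0r.
rewrite scale1r; have -> : (U_(j) - U_(j) = 0 :> 'X_{1..3})%MM by apply/mnmP => l; rewrite mnmBE mnm0E subnn.
by rewrite mpolyX0.
Qed.

Let hatE (D : 'M[R]_3) i : hat_mx D i 0 = \sum_j (D i j)%:MP * 'X_j.
Proof. by rewrite mxE; apply: eq_bigr => j _; rewrite !mxE. Qed.

Let lieX u i : lie_der u 'X_i = u i 0 :> {mpoly R[3]}.
Proof.
rewrite /lie_der (bigD1 i) //= xderE eqxx mulr1 big1 ?addr0 // => j /negPf ji.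
by rewrite xderE ji mulr0.
Qed.

Let linear_form (u : {mpoly R[3]}) :
  u \is 1.-homog -> exists a : 'I_3 -> R, forall i, mderiv i u = (a i)%:MP.
Proof.
move=> /dhomogP hu; exists (fun i => u@_U_(i)) => i; apply/mpolyP => m.
rewrite mcoeff_mderiv mcoeffC; have [->|m0] := eqVneq m 0%MM.
  by rewrite mnm0E add0m mulr1.
rewrite mulr0 memN_msupp_eq0 ?mul0rn //; apply/negP => /hu.
by rewrite /= mdegD mdeg1 addn1 => -[/eqP]; rewrite mdeg_eq0 (negPf m0).
Qed.

Let mderiv0_eq0 (g : {mpoly R[3]}) :
  g \is 2.-homog -> (forall i, mderiv i g = 0) -> g = 0.
Proof.
move=> /dhomogP hg dg; apply/mpolyP => m; rewrite mcoeff0.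
apply/eqP; rewrite mcoeff_eq0; apply/negP => mg; have := hg _ mg.
have [i mi|m0] := pickP (fun i => m i != 0%N); last first.
  have -> : m = 0%MM by apply/mnmP => i; rewrite mnm0E; apply/eqP/negbFE/m0.
  by rewrite /= mdeg0.
move=> _; have := congr1 (mcoeff (m - U_(i))%MM) (dg i).
rewrite mcoeff_mderiv submK ?lep1mP // mcoeff0 => /eqP.
by rewrite mulrn_eq0 /= mcoeff_eq0 mg.
Qed.

Let lie_homog (D : 'M[R]_3) (g : {mpoly R[3]}) :
  g \is 2.-homog -> lie_der (hat_mx D) g \is 2.-homog.
Proof.
move=> hg; apply: rpred_sum => i _; rewrite hatE mulr_suml.
apply: rpred_sum => j _; rewrite -mulrA mul_mpolyC; apply: rpredZ.
have hX : ('X_j : {mpoly R[3]}) \is 1.-homog by rewrite dhomogX /= mdeg1.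
suff hd : mderiv i g \is 1.-homog by have := dhomogM hX hd.
apply/dhomogP => m; rewrite mcoeff_msupp mcoeff_mderiv mulrn_eq0 /= -mcoeff_msupp.
by move=> /(dhomogP _ _ _ hg) /=; rewrite mdegD mdeg1 addn1 => -[].
Qed.

Let pbXX (P : bivector R) i j : pbracket P 'X_i 'X_j = P i j.
Proof.
rewrite /pbracket (bigD1 i) //= [X in _ + X]big1 => [|i' /negPf ii']; last first.
  by rewrite big1 // => j' _; rewrite !xderE ii' mulr0 mul0r.
rewrite addr0 (bigD1 j) //= big1 => [|j' /negPf jj'].
  by rewrite !xderE !eqxx !mulr1 addr0.
by rewrite !xderE jj' mulr0.
Qed.

Let lie_lin (D : 'M[R]_3) (u : {mpoly R[3]}) (a : 'I_3 -> R) :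
  (forall i, mderiv i u = (a i)%:MP) -> forall i,
  mderiv i (lie_der (hat_mx D) u) = \sum_j (D j i)%:MP * (a j)%:MP.
Proof.
move=> ha i; rewrite /lie_der !linear_sum /=; apply: eq_bigr => j _.
rewrite ha mderivM mderivC mulr0 addr0 hatE linear_sum /=.
rewrite (bigD1 i) //= mderiv_mulC xderE eqxx mulr1.
rewrite big1 ?addr0 // => l /negPf li.
by rewrite mderiv_mulC xderE eq_sym li mulr0.
Qed.

Let invariant (D : 'M[R]_3) (P : bivector R) : Prop := forall i j,
  lie_der (hat_mx D) (P i j) =
  \sum_l (D i l)%:MP * P l j + \sum_l (D j l)%:MP * P i l.

Let derE (D : 'M[R]_3) (P : bivector R) :
  (forall u v : {mpoly R[3]}, u \is 1.-homog -> v \is 1.-homog ->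
       lie_der (hat_mx D) (pbracket P u v) =
       pbracket P (lie_der (hat_mx D) u) v
       + pbracket P u (lie_der (hat_mx D) v)) <-> invariant D P.
Proof.
split=> [h i j|h u v /linear_form[a ua] /linear_form[b vb]].
  have hX l : ('X_l : {mpoly R[3]}) \is 1.-homog by rewrite dhomogX /= mdeg1.
  have := h _ _ (hX i) (hX j); rewrite pbXX !lieX => ->.
  have dh i' l : mderiv l (hat_mx D i' 0) = (D i' l)%:MP.
    rewrite hatE linear_sum /= (bigD1 l) //= mderiv_mulC xderE eqxx mulr1.
    rewrite big1 ?addr0 // => l' /negPf ll.
    by rewrite mderiv_mulC xderE eq_sym ll mulr0.
  have xsum i' (F : 'I_3 -> {mpoly R[3]}) : \sum_l F l * mderiv l 'X_i' = F i'.
    have := lieX (\col_l F l) i'; rewrite mxE => <-.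
    by apply: eq_bigr => l _; rewrite mxE.
  congr (_ + _); rewrite /pbracket.
    by apply: eq_bigr => l _; rewrite xsum dh mulrC.
  rewrite exchange_big /=; apply: eq_bigr => l _.
  rewrite -mulr_suml dh mulrC; congr (_ * _).
  by rewrite (xsum i (P^~ l)).
have lb : lie_der (hat_mx D) (pbracket P u v) = \sum_i \sum_j
    lie_der (hat_mx D) (P i j) * (a i)%:MP * (b j)%:MP.
  rewrite /pbracket {1}/lie_der.
  rewrite (eq_bigr (fun l => \sum_i \sum_j
    hat_mx D l 0 * mderiv l (P i j) * (a i)%:MP * (b j)%:MP)); last first.
    move=> l _; rewrite linear_sum /= mulr_sumr; apply: eq_bigr => i _.
    rewrite linear_sum /= mulr_sumr; apply: eq_bigr => j _.
    by rewrite ua vb !mderivM !mderivC !mulr0 !addr0 !mulrA.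
  rewrite exchange_big /=; apply: eq_bigr => i _.
  rewrite exchange_big /=; apply: eq_bigr => j _.
  by rewrite /lie_der !mulr_suml.
rewrite lb /pbracket.
rewrite (eq_bigr (fun i => \sum_j (\sum_l (D i l)%:MP * P l j
   + \sum_l (D j l)%:MP * P i l) * (a i)%:MP * (b j)%:MP)); last first.
  by move=> i _; apply: eq_bigr => j _; rewrite h.
rewrite [X in _ = X + _](eq_bigr (fun i => \sum_j P i j *
   (\sum_l (D l i)%:MP * (a l)%:MP) * (b j)%:MP)); last first.
  by move=> i _; apply: eq_bigr => j _; rewrite (lie_lin D ua) vb.
rewrite [X in _ = _ + X](eq_bigr (fun i => \sum_j P i j *
   (a i)%:MP * (\sum_l (D l j)%:MP * (b l)%:MP))); last first.
  by move=> i _; apply: eq_bigr => j _; rewrite (lie_lin D vb) ua.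
rewrite !sum3.
move: (a 0)%:MP (a 1)%:MP (a 2)%:MP (b 0)%:MP (b 1)%:MP (b 2)%:MP => *.
ring.
Qed.

Let bivecE (S : comPzRingType) (w : 'cV[S]_3) :
  [/\ bivec_of w 1 2 = w 0 0, bivec_of w 2 0 = w 1 0, bivec_of w 0 1 = w 2 0,
      forall i, bivec_of w i i = 0 &
      forall i j, bivec_of w i j = - bivec_of w j i].
Proof.
split; last first.
- move=> i j; rewrite /bivec_of /wedge; do ?rewrite !mxE ?big_ord1; ring.
- move=> i; rewrite /bivec_of /wedge; do ?rewrite !mxE ?big_ord1; ring.
all: rewrite /bivec_of /wedge; do ?rewrite !mxE ?big_ord1; rewrite /=; ring.
Qed.

Let hat1E i : hat_mx 1%:M i 0 = 'X_i :> {mpoly R[3]}.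
Proof.
rewrite hatE (bigD1 i) //= !mxE eqxx mul1r big1 ?addr0 // => j /negPf ji.
by rewrite mxE eq_sym ji mul0r.
Qed.

Let pi_linE (k : 'cV[R]_3) (f : {mpoly R[3]}) i j : pi_lin k f i j =
  (2^-1)%:MP * ('X_i * (k j 0)%:MP - (k i 0)%:MP * 'X_j) + pi_fun f i j.
Proof.
rewrite /pi_lin; move: (pi_fun f) => Q.
have hE l : hat_vec k l 0 = (k l 0)%:MP by rewrite mxE.
move: (hat_mx 1%:M) (hat_vec k) (@hat1E) hE => u v uE vE.
by rewrite !mxE !big_ord1 !mxE !uE !vE.
Qed.

Let pi_funE (f : {mpoly R[3]}) :
  [/\ pi_fun f 1 2 = mderiv 0 f, pi_fun f 2 0 = mderiv 1 f,
      pi_fun f 0 1 = mderiv 2 f, forall i, pi_fun f i i = 0 &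
      forall i j, pi_fun f i j = - pi_fun f j i].
Proof. by have [h1 h2 h3 h4 h5] := bivecE (\col_i mderiv i f); split; rewrite ?h1 ?h2 ?h3 ?mxE. Qed.

Lemma der0P (k : 'cV[R]_3) (f : {mpoly R[3]}) (D : 'M[R]_3) :
  f \is 2.-homog ->
  Der0 k f D <-> [/\ \tr D = 0, D *m k = 0 & lie_der (hat_mx D) f = 0].
Proof.
move=> hf; rewrite /Der0 /=.
set G := lie_der (hat_mx D) f.
pose c : {mpoly R[3]} := (2^-1)%:MP.
pose d i j : {mpoly R[3]} := (D i j)%:MP.
pose x (i : 'I_3) : {mpoly R[3]} := 'X_i.
pose kk i : {mpoly R[3]} := (k i 0)%:MP.
pose y i : {mpoly R[3]} := ((D *m k) i 0)%:MP.
pose P := pi_lin k f.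
pose w i := mderiv i f.
have yE i : y i = \sum_j d i j * kk j.
  by rewrite /y mxE rmorph_sum /=; apply: eq_bigr => j _; rewrite mpolyCM.
have dG m : mderiv m G = lie_der (hat_mx D) (w m) + \sum_i d i m * w i.
  rewrite /G /lie_der linear_sum /= -big_split /=; apply: eq_bigr => i _.
  rewrite mderivM addrC mderiv_comm; congr (_ + _ * _).
  rewrite hatE linear_sum /= (bigD1 m) //= mderiv_mulC xderE eqxx mulr1.
  rewrite big1 ?addr0 // => l /negPf lm.
  by rewrite mderiv_mulC xderE eq_sym lm mulr0.
have lieP i j : lie_der (hat_mx D) (P i j) =
    c * ((\sum_l d i l * x l) * kk j - kk i * (\sum_l d j l * x l))
    + lie_der (hat_mx D) (pi_fun f i j).
  rewrite /P pi_linE {1}/lie_der.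
  under eq_bigr => l _ do rewrite linearD /= mderiv_mulC linearB /= mderivM mderivC
    mulr0 addr0 mderiv_mulC mulrDr.
  rewrite big_split /=; congr (_ + _).
  rewrite (eq_bigr (fun l => c * (hat_mx D l 0 * mderiv l 'X_i * kk j
    - kk i * (hat_mx D l 0 * mderiv l 'X_j)))); last by move=> l _; rewrite /kk; ring.
  rewrite -mulr_sumr sumrB -mulr_suml -mulr_sumr.
  by rewrite -!/(lie_der _ _) !lieX !hatE.
have [w0 w1 w2 wD wN] := pi_funE f.
have lieN g : lie_der (hat_mx D) (- g) = - lie_der (hat_mx D) g.
  by rewrite /lie_der -sumrN; apply: eq_bigr => l _; rewrite linearN mulrN.
have PN i j : P i j = - P j i by rewrite /P !pi_linE wN; ring.
have PD i : P i i = 0 by rewrite /P !pi_linE wD; ring.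
have eqd (a b a' b' : {mpoly R[3]}) : a - b = a' - b' -> (a = b) <-> (a' = b').
  move=> e; split=> /eqP; rewrite -subr_eq0; [rewrite e|rewrite -e];
  by rewrite subr_eq0 => /eqP.
have key : \tr D = 0 -> invariant D P <->
  [/\ mderiv 0 G = c * (x 1 * y 2 - x 2 * y 1),
      mderiv 1 G = c * (x 2 * y 0 - x 0 * y 2) &
      mderiv 2 G = c * (x 0 * y 1 - x 1 * y 0)].
  move=> trD.
  pose E i j := lie_der (hat_mx D) (P i j) =
    \sum_l (D i l)%:MP * P l j + \sum_l (D j l)%:MP * P i l.
  have ED i : E i i.
    rewrite /E PD.
    have -> : lie_der (hat_mx D) 0 = 0.
      by rewrite /lie_der big1 // => l _; rewrite linear0 mulr0.
    by symmetry; rewrite -big_split big1 // => l _; rewrite (PN l i) /=; ring.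
  have EN i j : E i j -> E j i.
    rewrite /E (PN j i) lieN => ->; rewrite opprD addrC -!sumrN.
    by congr (_ + _); apply: eq_bigr => l _; rewrite PN mulrN ?opprK.
  have t2 : d 2 2 = - d 0 0 - d 1 1.
    have := congr1 (@mpolyC 3 R) trD; rewrite /mxtrace sum3 !mpolyCD mpolyC0 => e.
    apply/eqP; rewrite -subr_eq0 -e /d; apply/eqP; ring.
  have p12 := pi_linE k f 1 2; rewrite w0 in p12.
  have p20 := pi_linE k f 2 0; rewrite w1 in p20.
  have p01 := pi_linE k f 0 1; rewrite w2 in p01.
  have e12 : E 1 2 <-> mderiv 0 G = c * (x 1 * y 2 - x 2 * y 1).
    apply: eqd; rewrite dG lieP w0 !yE !sum3 !PD (PN 0 2) (PN 1 0) p12 p20 p01.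
    rewrite -!/(d _ _) -!/(x _) -!/(kk _) -!/(w _) -/c t2; ring.
  have e20 : E 2 0 <-> mderiv 1 G = c * (x 2 * y 0 - x 0 * y 2).
    apply: eqd; rewrite dG lieP w1 !yE !sum3 !PD (PN 2 1) (PN 1 0) p12 p20 p01.
    rewrite -!/(d _ _) -!/(x _) -!/(kk _) -!/(w _) -/c t2; ring.
  have e01 : E 0 1 <-> mderiv 2 G = c * (x 0 * y 1 - x 1 * y 0).
    apply: eqd; rewrite dG lieP w2 !yE !sum3 !PD (PN 0 2) (PN 2 1) p12 p20 p01.
    rewrite -!/(d _ _) -!/(x _) -!/(kk _) -!/(w _) -/c t2; ring.
  split=> [h|[/e12 h1 /e20 h2 /e01 h3] i j].
    by split; [apply/e12|apply/e20|apply/e01]; apply: h.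
  change (E i j).
  by case: (ord3P i) => ->; case: (ord3P j) => ->;
     (exact: ED || assumption || apply: EN).
have dx i j : mderiv i (x j) = (i == j)%:R by apply: xderE.
have dy i j : mderiv i (y j) = 0 by apply: mderivC.
have c0 : c != 0 by rewrite mpolyC_eq0 invr_eq0 pnatr_eq0.
split=> [[trD /derE /(key trD) [g0 g1 g2]]|[trD Dk G0]]; last first.
  split=> //; apply/derE; apply/(key trD); rewrite G0 !linear0.
  have y0 i : y i = 0 by rewrite /y Dk mxE mpolyC0.
  by rewrite !y0 !mulr0 subrr mulr0.
have dd i (a : {mpoly R[3]}) a' p q p' q' : a = c * (x p * y q - x p' * y q') ->
    mderiv i a = a' -> a' = c * ((i == p)%:R * y q - (i == p')%:R * y q').
  move=> -> <-; rewrite mderiv_mulC linearB /= !mderivM !dx !dy !mulr0 !addr0 //.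
have half (z : {mpoly R[3]}) : z - 0 = 0 - z -> z = 0.
  rewrite subr0 sub0r => /eqP; rewrite -subr_eq0 opprK -mulr2n -scaler_nat.
  by rewrite scaler_eq0 pnatr_eq0 => /eqP.
have y0 : y 0 = 0.
  have := dd 1 _ _ _ _ _ _ g2 (mderiv_comm _ _ _).
  rewrite (dd 2 _ _ _ _ _ _ g1 erefl) /= => /(mulfI c0).
  by rewrite !mul0r !mul1r => /half.
have y1 : y 1 = 0.
  have := dd 2 _ _ _ _ _ _ g0 (mderiv_comm _ _ _).
  rewrite (dd 0 _ _ _ _ _ _ g2 erefl) /= => /(mulfI c0).
  by rewrite !mul0r !mul1r => /half.
have y2 : y 2 = 0.
  have := dd 0 _ _ _ _ _ _ g1 (mderiv_comm _ _ _).
  rewrite (dd 1 _ _ _ _ _ _ g0 erefl) /= => /(mulfI c0).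
  by rewrite !mul0r !mul1r => /half.
split=> //.
  apply/matrixP => i j; rewrite [RHS]mxE (ord1 j).
  have: y i == 0; last by rewrite mpolyC_eq0 => /eqP.
  by apply/eqP; case: (ord3P i) => ->.
apply: mderiv0_eq0; first exact: lie_homog.
by move=> i; case: (ord3P i) => ->; rewrite ?g0 ?g1 ?g2 ?y0 ?y1 ?y2 !mulr0 subrr mulr0.
Qed.

End Sanity.

(* Main.v *)
Require Import Defs.
From mathcomp Require Import all_boot all_order all_algebra.
From mathcomp Require Import ring mpoly.
From mathcomp Require Import classical_sets reals.

(** In dimension three a bivector field is the same thing as a vector field [w],
    through [bivec_of]: [wedge u v] corresponds to the cross product [u x v], and
    [pi_g] to the gradient of [g].  In this language the Schouten bracket of the
    bivectors of [u] and [v] has a single independent component, equal up to sign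
    to [u . curl v + v . curl u] ([schouten_bivec_of]).  So everything reduces to
    knowing the curls of the two vector fields
      [u = 1/2 (X x k) + grad f]   and   [v = 1/3 (X x KX) + grad F].
    Gradients have no curl, and the formula for the curl of [X x w]
    ([curl_coords_cross]) gives [curl u = - k], and [curl v = - KX] because [K]
    is traceless ([curl_lin_field], [curl_quad_field]).  Since [KX . grad f] and
    [k . grad F] are the derivatives of [f] and [F] along [hat K] and [hat k],
    and since the triple products [(X x k) . KX] and [(X x KX) . k] are opposite,
    the bracket vanishes exactly when
      [hat k F + hat K f + (1/2 - 1/3) X . (k x KX) = 0]
    ([schouten_commute_pi]).  For [f = X A X^T] with [A] symmetric, [hat K f] is
    the quadratic form of [2 A K] ([lie_der_hat_mx_qform]), and [X . (k x KX)]
    that of [tilde k K] ([qform_tilde_mx]); this is the stated identity.  For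
    [k = 0] only [hat K f = 0] remains, and [der0P] identifies this condition
    with [K] being a traceless derivation. *)

Set Implicit Arguments.
Unset Strict Implicit.
Unset Printing Implicit Defensive.

Import GRing.Theory Num.Theory.
Local Open Scope classical_set_scope.
Local Open Scope ring_scope.

(** * Vector calculus in dimension three *)

Lemma sum_ord3 (S : nmodType) (F : 'I_3 -> S) : \sum_i F i = F 0 + F 1 + F 2.
Proof.
rewrite !big_ord_recr big_ord0 /= add0r.
by congr (F _ + F _ + F _); apply: val_inj.
Qed.

Lemma ord3P (i : 'I_3) : [\/ i = 0, i = 1 | i = 2].
Proof.
by case: i => [[|[|[|//]]]] h;
  [apply: Or31|apply: Or32|apply: Or33]; apply: val_inj.
Qed.

Lemma ord3_forall (Q : 'I_3 -> Prop) : Q 0 -> Q 1 -> Q 2 -> forall i, Q i.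
Proof. by move=> q0 q1 q2 i; case: (ord3P i) => ->. Qed.

Lemma ord3_add : ((0 : 'I_3) + 1 = 1) * ((0 : 'I_3) + 2 = 2) *
  ((1 : 'I_3) + 1 = 2) * ((1 : 'I_3) + 2 = 0) *
  ((2 : 'I_3) + 1 = 0) * ((2 : 'I_3) + 2 = 1).
Proof. by do ![split]; apply: val_inj. Qed.

Definition dot (S : pzRingType) (u v : 'cV[S]_3) : S := \sum_i u i 0 * v i 0.

Definition cross (S : pzRingType) (u v : 'cV[S]_3) : 'cV[S]_3 :=
  \col_i (u (i + 1) 0 * v (i + 2) 0 - u (i + 2) 0 * v (i + 1) 0).

Section Products.
Variable S : comPzRingType.
Implicit Types u v w : 'cV[S]_3.

Lemma dotC u v : dot u v = dot v u.
Proof. by apply: eq_bigr => i _; rewrite mulrC. Qed.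

Lemma dotDl u v w : dot (u + v) w = dot u w + dot v w.
Proof. by rewrite -big_split; apply: eq_bigr => i _; rewrite mxE mulrDl. Qed.

Lemma dotZl c u v : dot (c *: u) v = c * dot u v.
Proof. by rewrite [RHS]mulr_sumr; apply: eq_bigr => i _; rewrite mxE mulrA. Qed.

Lemma dotNr u v : dot u (- v) = - dot u v.
Proof. by rewrite -sumrN; apply: eq_bigr => i _; rewrite mxE mulrN. Qed.

Lemma dot0r u : dot u 0 = 0.
Proof. by rewrite /dot big1 // => i _; rewrite mxE mulr0. Qed.

Lemma cross0l u : cross 0 u = 0.
Proof. by apply/colP => i; rewrite !mxE !mul0r subrr. Qed.

Lemma triple_product_cycle u v w : dot (cross u v) w = dot u (cross v w).
Proof. rewrite /dot !sum_ord3 !mxE !ord3_add; ring. Qed.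

Lemma triple_product_swap u v w : dot (cross u w) v = - dot (cross u v) w.
Proof. rewrite /dot !sum_ord3 !mxE !ord3_add; ring. Qed.

(** The left-hand side is the shape taken by [u . curl v + v . curl u] for the
    vector fields of a linear and a quadratic Poisson structure. *)
Lemma dot_cross_pair a b x u v p q :
  dot (a *: cross x u + p) (- v) + dot (b *: cross x v + q) (- u) =
  - (dot u q + dot v p + (a - b) * dot x (cross u v)).
Proof.
rewrite !dotNr !dotDl !dotZl (triple_product_swap x u v) triple_product_cycle.
rewrite (dotC p) (dotC q); ring.
Qed.

Lemma bivec_ofE u :
  [/\ bivec_of u 1 2 = u 0 0, bivec_of u 2 0 = u 1 0, bivec_of u 0 1 = u 2 0,
      forall i, bivec_of u i i = 0 &
      forall i j, bivec_of u i j = - bivec_of u j i].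
Proof.
split; last first.
- move=> i j; rewrite /bivec_of /wedge; do ?rewrite !mxE ?big_ord1; ring.
- move=> i; rewrite /bivec_of /wedge; do ?rewrite !mxE ?big_ord1; ring.
all: rewrite /bivec_of /wedge; do ?rewrite !mxE ?big_ord1; rewrite /=; ring.
Qed.

Lemma bivec_ofD u v : bivec_of (u + v) = bivec_of u + bivec_of v.
Proof.
rewrite /bivec_of !mxE !scalerDl.
by rewrite [RHS]addrACA [X in _ = X + _]addrACA.
Qed.

Lemma bivec_ofZ c u : bivec_of (c *: u) = c *: bivec_of u.
Proof. by rewrite /bivec_of !mxE !scalerDr !scalerA. Qed.

Lemma bivec_of_mul u v : bivec_of u *m v = - cross u v.
Proof.
have [u0 u1 u2 uD uN] := bivec_ofE u.
apply/colP; elim/ord3_forall; rewrite mxE sum_ord3 ?uD ?(uN 0 2) ?(uN 1 0)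
  ?(uN 2 1) ?u0 ?u1 ?u2 !mxE !ord3_add; ring.
Qed.

Lemma wedgeE u v : wedge u v = bivec_of (cross u v).
Proof.
have [c0 c1 c2 cD cN] := bivec_ofE (cross u v).
have wE i j : wedge u v i j = u i 0 * v j 0 - v i 0 * u j 0.
  by rewrite !mxE !big_ord1 !mxE.
apply/matrixP; elim/ord3_forall; elim/ord3_forall;
  rewrite wE ?cD ?(cN 0 2) ?(cN 1 0) ?(cN 2 1) ?c0 ?c1 ?c2 ?mxE ?ord3_add; ring.
Qed.

End Products.

Section PoissonFields.
Variable R : realType.
Implicit Types (u v w : vfield R) (P Q : bivector R) (f g F : {mpoly R[3]}).
Implicit Types (k : 'cV[R]_3) (A K M : 'M[R]_3).

Definition grad g : vfield R := \col_i mderiv i g.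

Definition curl u : vfield R :=
  \col_i (mderiv (i + 1) (u (i + 2) 0) - mderiv (i + 2) (u (i + 1) 0)).

Definition divergence u : {mpoly R[3]} := \sum_i mderiv i (u i 0).

Lemma lie_derE u g : lie_der u g = dot u (grad g).
Proof. by apply: eq_bigr => i _; rewrite mxE. Qed.

Lemma curlD u v : curl (u + v) = curl u + curl v.
Proof. by apply/colP => i; rewrite !mxE !linearD addrACA. Qed.

Lemma curlZ (c : R) u : curl (c%:MP *: u) = c%:MP *: curl u.
Proof. by apply/colP => i; rewrite !mxE !mderiv_mulC mulrBr. Qed.

Lemma curl_grad g : curl (grad g) = 0.
Proof. by apply/colP => i; rewrite !mxE mderiv_comm subrr. Qed.

Lemma mderiv_coord i j : mderiv i 'X_j = (i == j)%:R :> {mpoly R[3]}.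
Proof.
rewrite mderivX mnm1E eq_sym; case: eqP => [->|_]; last by rewrite scale0r.
have -> : (U_(j) - U_(j) = 0 :> 'X_{1..3})%MM.
  by apply/mnmP => l; rewrite mnmBE mnm0E subnn.
by rewrite scale1r mpolyX0.
Qed.

Let X : vfield R := (coords R)^T.

Lemma coordsE i : X i 0 = 'X_i.
Proof. by rewrite !mxE. Qed.

(** This is the identity
    [curl (a x w) = (div w) a - (div a) w + (w . grad) a - (a . grad) w]
    for the position field [a = X], where [div X = 3] and [(w . grad) X = w]. *)
Lemma curl_coords_cross w : curl (cross X w) =
  divergence w *: X - 2 *: w - \col_i lie_der X (w i 0).
Proof.
apply/colP; elim/ord3_forall;
  rewrite !mxE /divergence /lie_der !sum_ord3 !ord3_add !linearB /=;
  rewrite !mderivM !coordsE !mderiv_coord /=; ring.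
Qed.

(** * The Schouten bracket in terms of curls *)

Lemma schouten_cycle P Q i j l : schouten P Q i j l = schouten P Q j l i.
Proof. by apply: eq_bigr => m _; ring. Qed.

Lemma schouten_swap P Q i j l :
  (forall a b, P a b = - P b a) -> (forall a b, Q a b = - Q b a) ->
  schouten P Q j i l = - schouten P Q i j l.
Proof.
move=> sP sQ; rewrite -sumrN; apply: eq_bigr => m _.
rewrite (sP i l) (sP l j) (sP j i) (sQ i l) (sQ l j) (sQ j i) !linearN /=; ring.
Qed.

Lemma schouten_bivec_of u v :
  schouten (bivec_of u) (bivec_of v) 0 1 2 = - (dot u (curl v) + dot v (curl u)).
Proof.
have [u0 u1 u2 uD uN] := bivec_ofE u; have [v0 v1 v2 vD vN] := bivec_ofE v.
rewrite /schouten /dot !sum_ord3.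
move: (bivec_of u) (bivec_of v) u0 u1 u2 uD uN v0 v1 v2 vD vN.
move=> P Q u0 u1 u2 uD uN v0 v1 v2 vD vN.
rewrite (uD 0) (uD 1) (uD 2) (vD 0) (vD 1) (vD 2).
rewrite (uN 0 2) (uN 1 0) (uN 2 1) (vN 0 2) (vN 1 0) (vN 2 1).
rewrite u0 u1 u2 v0 v1 v2 !mxE !ord3_add; ring.
Qed.

(** The bracket of two bivectors is totally skew-symmetric in its three indices,
    so over three coordinates its [0 1 2] component determines all the others. *)
Lemma schouten_commute_bivec_of u v :
  schouten_commute (bivec_of u) (bivec_of v) <->
  dot u (curl v) + dot v (curl u) = 0.
Proof.
have [_ _ _ _ uN] := bivec_ofE u; have [_ _ _ _ vN] := bivec_ofE v.
have := schouten_bivec_of u v; rewrite /schouten_commute.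
have := fun i j l => schouten_swap i j l uN vN.
have := schouten_cycle (bivec_of u) (bivec_of v).
move: (schouten _ _) => T cyc swp T012.
split=> [/(_ 0 1 2)/eqP|e i j l].
  by rewrite T012 oppr_eq0 => /eqP.
rewrite e oppr0 in T012.
have diag a b : T a a b = 0.
  apply/eqP; have /eqP := swp a a b.
  by rewrite -addr_eq0 -mulr2n -scaler_nat scaler_eq0 pnatr_eq0.
have T102 : T 1 0 2 = 0 by rewrite swp T012 oppr0.
move: i j l.
do 3![elim/ord3_forall];
  by do 3?[by rewrite ?diag ?T012 ?T102 | rewrite cyc].
Qed.

(** * Compatibility of the linear and the quadratic structures *)

Lemma hat_mxE M i : hat_mx M i 0 = \sum_j (M i j)%:MP * 'X_j.
Proof. by rewrite mxE; apply: eq_bigr => j _; rewrite !mxE. Qed.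

Lemma hat_mx1 : hat_mx 1%:M = X.
Proof. by rewrite /hat_mx map_mx1 mul1mx. Qed.

Lemma hat_mxM M N : hat_mx (M *m N) = map_mx (@mpolyC 3 R) M *m hat_mx N.
Proof. by rewrite /hat_mx map_mxM mulmxA. Qed.

Lemma mderiv_hat_mx M i j : mderiv j (hat_mx M i 0) = (M i j)%:MP.
Proof.
rewrite hat_mxE linear_sum (bigD1 j) //= mderiv_mulC mderiv_coord eqxx mulr1.
rewrite big1 ?addr0 // => l /negPf lj.
by rewrite mderiv_mulC mderiv_coord eq_sym lj mulr0.
Qed.

(** For a constant field [w] only the term [- 2 w] of [curl_coords_cross] is
    left. *)
Lemma curl_cross_hat_vec k : curl (cross X (hat_vec k)) = - 2 *: hat_vec k.
Proof.
have dk i j : mderiv j (hat_vec k i 0) = 0 by rewrite mxE mderivC.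
rewrite curl_coords_cross /divergence big1 // scale0r sub0r scaleNr.
rewrite -[RHS]subr0; congr (_ - _); apply/colP => i.
by rewrite !mxE /lie_der big1 // => j _; rewrite mderivC mulr0.
Qed.

(** The divergence of [hat K] is the trace of [K], and Euler's identity for its
    linear components adds one more [- hat K] to the term [- 2 hat K]. *)
Lemma curl_cross_hat_mx K :
  \tr K = 0 -> curl (cross X (hat_mx K)) = - 3 *: hat_mx K.
Proof.
move=> trK; rewrite curl_coords_cross.
have -> : divergence (hat_mx K) = 0.
  rewrite -(mpolyC0 3 R) -trK rmorph_sum /=.
  by apply: eq_bigr => i _; rewrite mderiv_hat_mx.
have -> : \col_i lie_der X (hat_mx K i 0) = hat_mx K.
  apply/colP => i; rewrite mxE [RHS]hat_mxE; apply: eq_bigr => j _.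
  by rewrite mderiv_hat_mx coordsE mulrC.
by apply/colP => i; rewrite !mxE; ring.
Qed.

Definition lin_field k f : vfield R :=
  (2^-1)%:MP *: cross X (hat_vec k) + grad f.

Definition quad_field K F : vfield R :=
  (3^-1)%:MP *: cross X (hat_mx K) + grad F.

Lemma pi_linE k f : pi_lin k f = bivec_of (lin_field k f).
Proof. by rewrite /pi_lin hat_mx1 wedgeE bivec_ofD bivec_ofZ. Qed.

Lemma pi_quadE K F : pi_quad K F = bivec_of (quad_field K F).
Proof. by rewrite /pi_quad hat_mx1 wedgeE bivec_ofD bivec_ofZ. Qed.

Lemma mpolyC_inv_nat n : n.+1%:R^-1%:MP * - n.+1%:R = -1 :> {mpoly R[3]}.
Proof.
by rewrite mulrN -mpolyC_nat -mpolyCM mulVf ?mpolyC1 // pnatr_eq0.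
Qed.

Lemma curl_lin_field k f : curl (lin_field k f) = - hat_vec k.
Proof.
rewrite curlD curlZ curl_grad addr0 curl_cross_hat_vec scalerA.
by rewrite (mpolyC_inv_nat 1) scaleN1r.
Qed.

Lemma curl_quad_field K F : \tr K = 0 -> curl (quad_field K F) = - hat_mx K.
Proof.
move=> trK; rewrite curlD curlZ curl_grad addr0 curl_cross_hat_mx // scalerA.
by rewrite (mpolyC_inv_nat 2) scaleN1r.
Qed.

(** The condition before [f] is written through a matrix; in this form it
    specializes directly to the unimodular case [k = 0]. *)
Lemma schouten_commute_pi k f K F : \tr K = 0 ->
  schouten_commute (pi_lin k f) (pi_quad K F) <->
  lie_der (hat_vec k) F + lie_der (hat_mx K) f
    + 6^-1 *: dot X (cross (hat_vec k) (hat_mx K)) = 0.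
Proof.
move=> trK; rewrite pi_linE pi_quadE.
apply: (iff_trans (schouten_commute_bivec_of _ _)).
rewrite curl_lin_field curl_quad_field // dot_cross_pair -!lie_derE.
have -> : (2^-1)%:MP - (3^-1)%:MP = (6^-1)%:MP :> {mpoly R[3]}.
  by rewrite -mpolyCB; congr _%:MP; field.
rewrite mul_mpolyC.
by split=> [/eqP|->]; rewrite ?oppr0 // oppr_eq0 => /eqP.
Qed.

(** * Quadratic forms *)

Lemma qformE M : qform M = dot X (hat_mx M).
Proof. by rewrite /qform -mulmxA mxE; apply: eq_bigr => i _; rewrite [X i 0]mxE. Qed.

Lemma qformD M N : qform (M + N) = qform M + qform N.
Proof. by rewrite /qform map_mxD mulmxDr mulmxDl mxE. Qed.

Lemma qformZ (c : R) M : qform (c *: M) = c *: qform M.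
Proof. by rewrite /qform map_mxZ -scalemxAr -scalemxAl mxE mul_mpolyC. Qed.

(** Each monomial is differentiated through both of its factors; the two
    contributions are [A X] and [A^T X], which agree by symmetry. *)
Lemma grad_qform A : A^T = A -> grad (qform A) = 2 *: hat_mx A.
Proof.
move=> sA; apply/colP => i; rewrite mxE [RHS]mxE.
rewrite qformE [LHS]linear_sum /=.
under eq_bigr do rewrite mderivM mderiv_hat_mx coordsE mderiv_coord.
rewrite big_split /= (bigD1 i) //= eqxx mul1r big1 ?addr0; last first.
  by move=> j /negPf ji; rewrite eq_sym ji mul0r.
rewrite mulr_natl mulr2n; congr (_ + _); rewrite hat_mxE.
by apply: eq_bigr => j _; rewrite mulrC -[in LHS]sA mxE.
Qed.

Lemma lie_der_hat_mx_qform A K :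
  A^T = A -> lie_der (hat_mx K) (qform A) = 2 *: qform (A *m K).
Proof.
move=> sA; rewrite lie_derE grad_qform // dotC dotZl -mul_mpolyC mpolyC_nat.
congr (_ * _); rewrite qformE hat_mxM; move: (hat_mx K) => w; rewrite /dot.
under eq_bigr => i _ do rewrite (hat_mxE A) mulr_suml.
under [RHS]eq_bigr => i _ do rewrite coordsE mxE mulr_sumr.
rewrite exchange_big; apply: eq_bigr => i _; apply: eq_bigr => j _.
by rewrite -[in LHS]sA !mxE; ring.
Qed.

Lemma map_bivec_of k : map_mx (@mpolyC 3 R) (bivec_of k) = bivec_of (hat_vec k).
Proof.
have map_wedge i j : map_mx (@mpolyC 3 R) (wedge (basis_vec R i) (basis_vec R j))
    = wedge (basis_vec _ i) (basis_vec _ j).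
  by rewrite /wedge map_mxB !map_mxM -!map_trmx !map_delta_mx.
by rewrite /bivec_of !map_mxD !map_mxZ !map_wedge !mxE.
Qed.

Lemma qform_tilde_mx k K :
  qform (tilde_mx k *m K) = dot X (cross (hat_vec k) (hat_mx K)).
Proof.
by rewrite qformE hat_mxM map_mxN mulNmx map_bivec_of bivec_of_mul opprK.
Qed.

End PoissonFields.

Theorem theorem3p1 (R : realType) :
  (forall (k : 'cV[R]_3) (f : {mpoly R[3]}) (A : 'M[R]_3)
      (K : 'M[R]_3) (F : {mpoly R[3]}),
      lin_compatible k f -> quad_compatible (K, F) ->
      A^T = A -> f = qform A ->
      Cset k f (K, F) <->
      lie_der (hat_vec k) F =
        (- (6^-1)) *: qform ((12 *: A + tilde_mx k) *m K)) /\
  (forall f : {mpoly R[3]}, lin_compatible 0 f ->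
      Cset 0 f =
        [set p | quad_compatible p /\ lie_der (hat_mx p.1) f = 0] /\
      Cset 0 f =
        [set p | quad_compatible p /\ Der0 0 f p.1]).
Proof.
split=> [k f A K F _ KF sA ->|f [f2 _]].
  have trK : \tr K = 0 by case: KF.
  have sch := schouten_commute_pi k (qform A) F trK.
  rewrite lie_der_hat_mx_qform // -qform_tilde_mx -addrA in sch.
  have e : 2 *: qform (A *m K) + 6^-1 *: qform (tilde_mx k *m K) =
      6^-1 *: qform ((12 *: A + tilde_mx k) *m K).
    rewrite mulmxDl -scalemxAl qformD qformZ scalerDr scalerA.
    by congr (_ *: _ + _); field.
  have CE : Cset k (qform A) (K, F) <->
      schouten_commute (pi_lin k (qform A)) (pi_quad K F) by split=> [[]|].
  rewrite e in sch; apply: (iff_trans CE); apply: (iff_trans sch).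
  rewrite scaleNr.
  by split=> [/eqP|->]; rewrite ?addNr // addr_eq0 => /eqP.
have C0 : Cset 0 f = [set p | quad_compatible p /\ lie_der (hat_mx p.1) f = 0].
  have sch (K : 'M[R]_3) (F : {mpoly R[3]}) : \tr K = 0 ->
      schouten_commute (pi_lin 0 f) (pi_quad K F) <-> lie_der (hat_mx K) f = 0.
    move=> trK; apply: (iff_trans (schouten_commute_pi 0 f F trK)).
    by rewrite lie_derE /hat_vec map_mx0 cross0l dotC !dot0r scaler0 add0r addr0.
  by apply/seteqP; split=> -[K F] [KF]; have [trK _] := KF; move/(sch K F trK).
split=> //; rewrite C0; apply/seteqP; split=> -[K F] [KF] /=; have [trK _] := KF.
  by move=> Kf; split=> //; apply/der0P; rewrite ?mulmx0.
by move=> /(der0P _ _ f2) [_ _ Kf].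
Qed.
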